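(* Let $1<p_0<p<\infty$, $p'=p/(p-1)$, and let $f,g$ be nonnegative sequences on $\mathbb{Z}_+$. Assume there is a positive increasing function $\varphi_{p_0}$ on $[1,\infty)$ such that for every $w_0\in\mathcal{A}_{p_0}$, $$\Big(\sum_{k=1}^\infty w_0(k)f(k)^{p_0}\Big)^{1/p_0}\le\varphi_{p_0}\big([w_0]_{\mathcal{A}_{p_0}}\big)\Big(\sum_{k=1}^\infty w_0(k)g(k)^{p_0}\Big)^{1/p_0}.$$ Then for every $w\in\mathcal{A}_p$ with $f\in\ell^p(w)$, $$\Big(\sum_{k=1}^\infty w(k)f(k)^{p}\Big)^{1/p}\le 2^{\frac{p-p_0}{(p-1)p_0}}\,\varphi_{p_0}\Big(\big(2\|\mathcal{M}\|_{\ell^{p'}(w^{1-p'})}\big)^{\frac{p-p_0}{p-1}}[w]_{\mathcal{A}_p}^{\frac{p_0-1}{p-1}}\Big)\Big(\sum_{k=1}^\infty w(k)g(k)^{p}\Big)^{1/p}.$$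
   Context: Throughout, a weight is a sequence $w=\{w(k)\}_{k\ge 1}$ of strictly positive real numbers indexed by $\mathbb{Z}_+=\{1,2,\dots\}$. For $1\le q<\infty$ and a weight $v$, $\ell^q(v)$ is the space of real sequences $f$ with $\|f\|_{\ell^q(v)}=\big(\sum_{k\ge1}v(k)|f(k)|^q\big)^{1/q}<\infty$. The discrete Hardy–Littlewood maximal operator is $\mathcal{M}f(k)=\sup_{n\ge k}\frac1n\sum_{j=1}^n|f(j)|$, $k\in\mathbb{Z}_+$. For $1<q<\infty$, a weight $w$ belongs to $\mathcal{A}_q$ iff $[w]_{\mathcal{A}_q}:=\sup_{n\ge1}\big(\frac1n\sum_{k=1}^n w(k)\big)\big(\frac1n\sum_{k=1}^n w(k)^{-1/(q-1)}\big)^{q-1}<\infty$. $\|\mathcal{M}\|_{\ell^q(v)}$ denotes the operator norm $\sup\{\|\mathcal{M}f\|_{\ell^q(v)}:\|f\|_{\ell^q(v)}\le1\}$; it is known to be finite when $v\in\mathcal{A}_q$ (and $w\in\mathcal{A}_p$ implies $w^{1-p'}\in\mathcal{A}_{p'}$). *)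

(* Defs.v *)
(* Sequences on Z_+ = {1,2,...} are modelled as
   functions nat -> R of which only the values at k >= 1 are ever used. *)
From HB Require Import structures.
From mathcomp Require Import all_boot all_order all_algebra.
From mathcomp Require Import all_classical all_reals all_analysis.
Set Implicit Arguments. Unset Strict Implicit. Unset Printing Implicit Defensive.
Import Order.TTheory GRing.Theory Num.Theory.
Local Open Scope ring_scope.
Local Open Scope ereal_scope.

Section Defs.
Variable R : realType.

Definition is_weight (w : nat -> R) : Prop := forall k, (1 <= k)%N -> (0 < w k)%R.

Definition avg (u : nat -> R) (n : nat) : R :=
  ((n%:R)^-1 * \sum_(1 <= k < n.+1) u k)%R.

Definition Aq_const (q : R) (w : nat -> R) : \bar R :=
  ereal_sup [set ((avg w n) * (avg (fun k => w k `^ (- (q - 1)^-1)) n) `^ (q - 1))%:E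
            | n in [set n : nat | (1 <= n)%N]].

Definition in_Aq (q : R) (w : nat -> R) : Prop := Aq_const q w < +oo.

Definition lq_norm (q : R) (v f : nat -> R) : \bar R :=
  (\sum_(1 <= k <oo) ((v k) * `|f k| `^ q)%:E) `^ q^-1.

Definition maxM (f : nat -> R) (k : nat) : \bar R :=
  ereal_sup [set (avg (fun j => `|f j|) n)%:E | n in [set n : nat | (k <= n)%N]].

(* ||F||_{l^q(v)} for an extended-real valued (nonnegative) sequence F *)
Definition lq_normE (q : R) (v : nat -> R) (F : nat -> \bar R) : \bar R :=
  (\sum_(1 <= k <oo) ((v k)%:E * (F k `^ q))) `^ q^-1.

Definition M_opnorm (q : R) (v : nat -> R) : \bar R :=
  ereal_sup [set lq_normE q v (maxM f) | f in [set f : nat -> R | lq_norm q v f <= 1]].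

End Defs.

(* Main.v *)
(* Let v = w ^ (1 - p') and N = ||M|| on l^p'(v). A Rubio de Francia majorant u
   of f ^ (p - 1) w in l^p'(v) satisfies ||u|| <= 2 ||f ^ (p - 1) w|| and
   M u <= 2 N u, so w0 = u ^ t * w ^ (1 - t) with t = (p - p0) / (p - 1) has
   [w0]_{A_p0} <= (2 N) ^ t * [w]_{A_p} ^ (1 - t). Since w0 f ^ p0 >= w f ^ p, the
   hypothesis for w0 followed by Hoelder's inequality for w0 g ^ p0 gives the
   bound, after division by a power of ||f||; this needs ||f|| < +oo.
   N must be finite for this to make sense. That is Muckenhoupt's theorem, which
   for averages over initial segments reduces, as in Lerner's proof, to Doob's
   maximal inequality for weighted averages. *)
Require Import Defs.
From HB Require Import structures.
From mathcomp Require Import all_boot all_order all_algebra.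
From mathcomp Require Import all_classical all_reals all_analysis.
From mathcomp Require Import lra ring.
Set Implicit Arguments. Unset Strict Implicit. Unset Printing Implicit Defensive.
Import Order.TTheory GRing.Theory Num.Theory.
Import numFieldNormedType.Exports.
Local Open Scope ring_scope.

(** * Doob's maximal inequality for weighted averages *)

Section FiniteSums.
Context {R : realType}.
Implicit Types (a b x y t q : R) (m n N k : nat).

Lemma ler_powR2r x y q : 0 <= q -> 0 <= x -> x <= y -> x `^ q <= y `^ q.
Proof.
move=> q0 x0 xy; apply: ge0_ler_powR; rewrite ?nnegrE//.
exact: le_trans xy.
Qed.

Lemma powR_invK x q : 0 <= x -> q != 0 -> (x `^ q) `^ q^-1 = x.
Proof. by move=> x0 q0; rewrite -powRrM divff// powRr1. Qed.

Lemma powRVK x q : 0 <= x -> q != 0 -> (x `^ q^-1) `^ q = x.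
Proof. by move=> x0 q0; rewrite -powRrM mulVf// powRr1. Qed.

Lemma amgm_powR x y t : 0 < t -> t < 1 -> 0 <= x -> 0 <= y ->
  x `^ t * y `^ (1 - t) <= t * x + (1 - t) * y.
Proof.
move=> t0 t1 x0 y0.
have u0 : 0 < 1 - t by rewrite subr_gt0.
have := @conjugate_powR R (x `^ t) (y `^ (1 - t)) t^-1 (1 - t)^-1.
rewrite !powR_ge0 !invr_gt0 t0 u0 !invrK !powR_invK ?gt_eqF//.
rewrite [t + _]addrC subrK => /(_ isT isT isT isT erefl).
by rewrite [x * t]mulrC [y * (1 - t)]mulrC.
Qed.

Lemma term_le_sum (F : nat -> R) m n k :
  (forall i, (m <= i < n)%N -> 0 <= F i) -> (m <= k < n)%N ->
  F k <= \sum_(m <= i < n) F i.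
Proof.
move=> F0 kmn; rewrite (bigD1_seq k) ?mem_index_iota ?iota_uniq//=.
rewrite lerDl big_seq_cond sumr_ge0// => i.
by rewrite mem_index_iota => /andP[/F0].
Qed.

Lemma sumr_nat_ge0 (F : nat -> R) m n :
  (forall i, (m <= i < n)%N -> 0 <= F i) -> 0 <= \sum_(m <= i < n) F i.
Proof. by move=> F0; rewrite big_nat sumr_ge0. Qed.

Lemma ler_sum_nat_ub (F : nat -> R) n n' :
  (forall i, (1 <= i)%N -> 0 <= F i) -> (n <= n')%N ->
  \sum_(1 <= i < n) F i <= \sum_(1 <= i < n') F i.
Proof.
case: n => [|n] F0 nn'.
  by rewrite big_geq// sumr_nat_ge0// => i /andP[/F0].
rewrite (@big_cat_nat _ _ _ n.+1 1 n')//= lerDl sumr_nat_ge0// => i /andP[ni _].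
exact/F0/(leq_trans _ ni).
Qed.

(** Weighted AM-GM applied termwise to the normalised [x k / X] and [y k / Y]. A vanishing sum is
    treated apart: then each of its terms vanishes. *)
Lemma holder_sum (x y : nat -> R) t m n : 0 < t -> t < 1 ->
  (forall k, (m <= k < n)%N -> 0 <= x k) ->
  (forall k, (m <= k < n)%N -> 0 <= y k) ->
  \sum_(m <= k < n) (x k `^ t * y k `^ (1 - t)) <=
  (\sum_(m <= k < n) x k) `^ t * (\sum_(m <= k < n) y k) `^ (1 - t).
Proof.
move=> t0 t1 x0 y0.
have u0 : 0 < 1 - t by rewrite subr_gt0.
set X := \sum_(m <= k < n) x k; set Y := \sum_(m <= k < n) y k.
have X0 : 0 <= X by exact: sumr_nat_ge0.
have Y0 : 0 <= Y by exact: sumr_nat_ge0.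
have [XE|XN0] := eqVneq X 0.
  rewrite big_nat big1 ?mulr_ge0 ?powR_ge0// => k kmn.
  suff -> : x k = 0 by rewrite powR0 ?mul0r ?gt_eqF.
  by apply/eqP; rewrite eq_le x0// andbT -XE term_le_sum.
have [YE|YN0] := eqVneq Y 0.
  rewrite big_nat big1 ?mulr_ge0 ?powR_ge0// => k kmn.
  suff -> : y k = 0 by rewrite (@powR0 _ (1 - t)) ?mulr0 ?gt_eqF.
  by apply/eqP; rewrite eq_le y0// andbT -YE term_le_sum.
have Xp : 0 < X by rewrite lt0r XN0.
have Yp : 0 < Y by rewrite lt0r YN0.
have XYp : 0 < X `^ t * Y `^ (1 - t) by rewrite mulr_gt0// powR_gt0.
apply: (@le_trans _ _ (\sum_(m <= k < n)
   X `^ t * Y `^ (1 - t) * (t * (x k / X) + (1 - t) * (y k / Y)))).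
  apply: ler_sum_nat => k kmn.
  have {1}-> : x k = X * (x k / X) by rewrite mulrC divfK.
  have {1}-> : y k = Y * (y k / Y) by rewrite mulrC divfK.
  have ? : 0 <= x k / X by rewrite divr_ge0// x0.
  have ? : 0 <= y k / Y by rewrite divr_ge0// y0.
  by rewrite (powRM _ X0)// (powRM _ Y0)// mulrACA ler_pM2l// amgm_powR.
rewrite -mulr_sumr ger_pMr// big_split/= -!mulr_sumr -!mulr_suml.
by rewrite !divff// !mulr1 [t + _]addrC subrK.
Qed.

(** Divide by [S ^ (1 - t)], which is legitimate because [S] is a real number and the case [S = 0]
    is trivial. This closes self-referential estimates produced by Hoelder. *)
Lemma absorb_powR S A c t : 0 <= S -> 0 <= A -> 0 <= c -> 0 < t ->
  S <= c * (A `^ t * S `^ (1 - t)) -> S <= c `^ t^-1 * A.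
Proof.
move=> S0 A0 c0 t0 H.
have [->|SN0] := eqVneq S 0; first by rewrite mulr_ge0// powR_ge0.
have Sp : 0 < S by rewrite lt0r SN0.
have : S `^ t <= c * A `^ t.
  rewrite -(ler_pM2r (powR_gt0 (1 - t) Sp)) -mulrA -powRD ?SN0 ?implybT//.
  by rewrite addrC subrK powRr1.
move=> /(@ler_powR2r _ _ t^-1); rewrite powR_invK ?gt_eqF// powRM ?powR_ge0//.
by rewrite powR_invK ?gt_eqF//; apply; rewrite ?powR_ge0// invr_ge0 ltW.
Qed.

(** Young's inequality with exponent [q] and its conjugate, under which [y ^ (q - 1)] becomes
    [y ^ q]. *)
Lemma mul_powR_le x y q : 1 < q -> 0 <= x -> 0 <= y ->
  x * y `^ (q - 1) <= q^-1 * x `^ q + (1 - q^-1) * y `^ q.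
Proof.
move=> q1 x0 y0; have q0 : 0 < q by lra.
have := @amgm_powR (x `^ q) (y `^ q) q^-1.
rewrite invr_gt0 q0 invf_lt1// q1 !powR_ge0 powR_invK// ?gt_eqF//.
rewrite -[_ `^ (1 - _)]powRrM mulrBr mulr1 divff ?gt_eqF//.
exact.
Qed.

Lemma powR_sub_le x y q : 1 < q -> 0 <= x -> 0 <= y ->
  x `^ q - y `^ q <= q / (q - 1) * (x * (x `^ (q - 1) - y `^ (q - 1))).
Proof.
move=> q1 x0 y0; have q0 : 0 < q by lra.
have q10 : 0 < q - 1 by lra.
rewrite mulrBr mulr_powRB1// -subr_ge0.
have -> : q / (q - 1) * (x `^ q - x * y `^ (q - 1)) - (x `^ q - y `^ q) =
  q / (q - 1) * (q^-1 * x `^ q + (1 - q^-1) * y `^ q - x * y `^ (q - 1)).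
  field; lra.
by rewrite mulr_ge0 ?divr_ge0 ?subr_ge0 ?mul_powR_le// ltW.
Qed.

(** Convexity without derivatives: Young's inequality for [x] and for [y] against the midpoint [z],
    added up, since [x + y = 2 * z]. *)
Lemma powR_midpoint_le x y q : 1 < q -> 0 <= x -> 0 <= y ->
  ((x + y) / 2) `^ q <= (x `^ q + y `^ q) / 2.
Proof.
move=> q1 x0 y0; have q0 : 0 < q by lra.
set z := (x + y) / 2; have z0 : 0 <= z by rewrite /z; lra.
have zE : x * z `^ (q - 1) + y * z `^ (q - 1) = 2 * z `^ q.
  by rewrite -mulrDl -(mulr_powRB1 z0 q0) mulrA; congr (_ * _); rewrite /z; field.
have := lerD (mul_powR_le q1 x0 z0) (mul_powR_le q1 y0 z0).
rewrite zE; move: (x `^ q) (y `^ q) (z `^ q) => a b c H.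
have qV : 0 < q^-1 by rewrite invr_gt0.
suff : 0 <= q^-1 * (a + b - 2 * c) by rewrite pmulr_rge0//; lra.
by move: H; rewrite -subr_ge0; congr (0 <= _); ring.
Qed.

(** A truncated maximal function, so that only finite sums and maxima occur. The default [0] is
    harmless for nonnegative [A], and an empty tail gives [0]. *)
Definition tail_max (A : nat -> R) k N : R := \big[Num.max/0]_(k <= n < N) A n.

Lemma tail_max_ge0 A k N : 0 <= tail_max A k N.
Proof.
by rewrite /tail_max; elim/big_rec: _ => // i x _ x0; rewrite le_max x0 orbT.
Qed.

Lemma le_tail_max A k n N : (k <= n < N)%N -> A n <= tail_max A k N.
Proof.
by move=> knN; apply: (le_bigmax_seq 0 n predT A); rewrite ?mem_index_iota.
Qed.

Lemma tail_max_le A k N x : 0 <= x ->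
  (forall n, (k <= n < N)%N -> A n <= x) -> tail_max A k N <= x.
Proof.
by move=> x0 Ax; rewrite /tail_max big_nat; apply: bigmax_le.
Qed.

Lemma tail_max_recl A k N : (forall n, (k <= n)%N -> 0 <= A n) ->
  tail_max A k.+1 N <= tail_max A k N /\
  (tail_max A k N = tail_max A k.+1 N \/ tail_max A k N = A k).
Proof.
move=> A0; have [kN|Nk] := ltnP k N; last first.
  by rewrite /tail_max !big_geq//; [split; [|left]|exact: leqW].
rewrite [tail_max A k N]/tail_max big_ltn// -/(tail_max A k.+1 N).
rewrite le_max lexx orbT; split => //.
by case: (leP (A k)) => _; [left|right].
Qed.

(* Summation by parts: where the decreasing sequence [M] drops it is a ratio of
   partial sums, so that [powR_sub_le] applies to the drop of [M ^ q]. *)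
Lemma maximal_abel q (s b M : nat -> R) m : 1 < q ->
  (forall k, (1 <= k)%N -> 0 <= s k) ->
  (forall k, 0 <= M k) ->
  (forall k, (1 <= k)%N -> M k.+1 <= M k /\ (M k = M k.+1 \/
    M k * \sum_(1 <= j < k.+1) s j = \sum_(1 <= j < k.+1) b j)) ->
  \sum_(1 <= k < m.+1) s k * M k `^ q
    - (\sum_(1 <= k < m.+1) s k) * M m.+1 `^ q <=
  q / (q - 1) * (\sum_(1 <= k < m.+1) b k * M k `^ (q - 1)
    - (\sum_(1 <= k < m.+1) b k) * M m.+1 `^ (q - 1)).
Proof.
move=> q1 s0 M0 HM; elim: m => [|m IH].
  by rewrite !big_geq// !mul0r subrr mulr0.
have [le_M HMm] := HM m.+1 isT.
rewrite (@big_nat_recr _ _ _ m.+1 1 (fun k => s k * M k `^ q))//=.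
rewrite (@big_nat_recr _ _ _ m.+1 1 (fun k => b k * M k `^ (q - 1)))//=.
set S' := \sum_(1 <= k < m.+2) s k; set B' := \sum_(1 <= k < m.+2) b k.
have SE : S' = \sum_(1 <= k < m.+1) s k + s m.+1 by rewrite /S' big_nat_recr.
have BE : B' = \sum_(1 <= k < m.+1) b k + b m.+1 by rewrite /B' big_nat_recr.
have S0 : 0 <= S' by rewrite /S' sumr_nat_ge0// => i /andP[/s0].
(* Passing from [m] to [m.+1] increases the two sides of the claim by exactly the two sides of
   [key]. *)
have key : S' * (M m.+1 `^ q - M m.+2 `^ q) <=
    q / (q - 1) * (B' * (M m.+1 `^ (q - 1) - M m.+2 `^ (q - 1))).
  move: HMm; rewrite -/S' -/B' => -[->|<-]; first by rewrite !subrr !mulr0.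
  by rewrite [M _ * S']mulrC -[S' * _ * _]mulrA mulrCA ler_wpM2l// powR_sub_le.
move: IH key; rewrite SE BE.
move: (\sum_(1 <= k < m.+1) s k * _) (\sum_(1 <= k < m.+1) s k).
move: (\sum_(1 <= k < m.+1) b k * _) (\sum_(1 <= k < m.+1) b k).
move: (M m.+1 `^ q) (M m.+2 `^ q) (M m.+1 `^ (q - 1)) (M m.+2 `^ (q - 1)).
move=> a1 a2 a3 a4 d1 d2 d3 d4 h1 h2.
rewrite -subr_ge0; move: h1 h2; rewrite -subr_ge0 => h1; rewrite -subr_ge0 => h2.
by apply: le_trans (addr_ge0 h1 h2) _; rewrite le_eqVlt; apply/orP; left; apply/eqP; ring.
Qed.

(** Doob's inequality for [b / s] and the measure [s], with a constant independent of [s]. Summation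
    by parts bounds the sum of [s * M ^ q] by that of [b * M ^ (q - 1)]; Hoelder and absorption then
    conclude. *)
Lemma weighted_maximal q (s b : nat -> R) N : 1 < q ->
  (forall k, (1 <= k)%N -> 0 < s k) -> (forall k, (1 <= k)%N -> 0 <= b k) ->
  \sum_(1 <= k < N) s k * tail_max
     (fun n => (\sum_(1 <= j < n.+1) b j) / (\sum_(1 <= j < n.+1) s j)) k N `^ q
  <= (q / (q - 1)) `^ q * \sum_(1 <= k < N) s k * (b k / s k) `^ q.
Proof.
move=> q1 s0 b0; set A := fun n => _ / _; pose M k := tail_max A k N.
have q0 : 0 < q by lra.
have M0 k : 0 <= M k by exact: tail_max_ge0.
have S0 k : (1 <= k)%N -> 0 < \sum_(1 <= j < k.+1) s j.
  move=> k1; apply: (lt_le_trans (s0 _ k1)); apply: term_le_sum.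
    by move=> i /andP[/s0/ltW].
  by rewrite k1 ltnSn.
have A0 n : (1 <= n)%N -> 0 <= A n.
  move=> n1; rewrite divr_ge0// ?(ltW (S0 _ _))//.
  by rewrite sumr_nat_ge0// => i /andP[/b0].
have HM k : (1 <= k)%N -> M k.+1 <= M k /\ (M k = M k.+1 \/
    M k * \sum_(1 <= j < k.+1) s j = \sum_(1 <= j < k.+1) b j).
  move=> k1; have [|? HMk] := @tail_max_recl A k N.
    by move=> n kn; exact/A0/(leq_trans k1).
  split=> //; case: HMk => HMk; [by left|right].
  by rewrite /M HMk /A divfK// gt_eqF// S0.
case: N @M M0 HM => [|m] M M0 HM.
  by rewrite !big_geq// mulr0.
have := @maximal_abel q s b M m q1 (fun k h => ltW (s0 k h)) M0 HM.
(* The tail starting at [N] is empty, so both boundary terms of the summation by parts vanish. *)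
rewrite (_ : M m.+1 = 0) ?powR0 ?gt_eqF ?subr_gt0//; last first.
  by rewrite /M /tail_max big_geq.
rewrite !mulr0 !subr0 => H.
have -> : (q / (q - 1)) `^ q = (q / (q - 1)) `^ (q^-1)^-1 by rewrite invrK.
apply: absorb_powR.
- by rewrite sumr_nat_ge0// => i /andP[/s0/ltW ? _]; rewrite mulr_ge0// powR_ge0.
- by rewrite sumr_nat_ge0// => i /andP[/s0/ltW ? _]; rewrite mulr_ge0// powR_ge0.
- by rewrite divr_ge0//; lra.
- by rewrite invr_gt0.
apply: (le_trans H); rewrite ler_wpM2l//; first by rewrite divr_ge0//; lra.
(* Hoelder with weight [q^-1], for the splitting of [b * M ^ (q - 1)] into
   [(s * (b / s) ^ q) ^ q^-1] and [(s * M ^ q) ^ (1 - q^-1)]. *)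
apply: le_trans (@holder_sum _ _ _ _ _ _ _ _ _); last 4 first.
- by rewrite invr_gt0.
- by rewrite invf_lt1.
- by move=> k /andP[/s0/ltW ? _]; rewrite mulr_ge0// powR_ge0.
- by move=> k /andP[/s0/ltW ? _]; rewrite mulr_ge0// powR_ge0.
apply: ler_sum_nat => k /andP[k1 _]; have sk := s0 _ k1.
rewrite !(powRM _ (ltW sk)) ?powR_ge0//.
rewrite powR_invK ?gt_eqF ?divr_ge0 ?b0 ?(ltW sk)//.
rewrite mulrACA -powRD ?(gt_eqF sk) ?implybT//.
rewrite (_ : q^-1 + (1 - q^-1) = 1); last by rewrite addrC subrK.
rewrite powRr1 ?(ltW sk)// mulrA [s k * _]mulrC divfK ?gt_eqF//.
by rewrite -[_ `^ (1 - _)]powRrM mulrBr mulr1 divff ?gt_eqF.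
Qed.

End FiniteSums.

(** * Muckenhoupt's theorem *)

Section Maximal.
Context {R : realType}.
Implicit Types (q K B : R) (v F f : nat -> R) (m n N k : nat).

Lemma is_weight_ge0 v k : is_weight v -> (1 <= k)%N -> 0 <= v k.
Proof. by move=> wv k1; exact/ltW/wv. Qed.

Lemma weight_sum_gt0 v n : is_weight v -> (1 <= n)%N ->
  0 < \sum_(1 <= k < n.+1) v k.
Proof.
move=> wv n1; apply: (lt_le_trans (wv _ n1)); apply: term_le_sum.
  by move=> i /andP[/wv/ltW].
by rewrite n1 ltnSn.
Qed.

Lemma avg_gt0 v n : is_weight v -> (1 <= n)%N -> 0 < avg v n.
Proof.
move=> wv n1; rewrite mulr_gt0 ?invr_gt0 ?ltr0n//; exact: weight_sum_gt0.
Qed.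

Lemma avg_ge0 f n : (forall k, (1 <= k)%N -> 0 <= f k) -> 0 <= avg f n.
Proof.
move=> f0; rewrite mulr_ge0 ?invr_ge0//.
by rewrite sumr_nat_ge0// => i /andP[/f0].
Qed.

Lemma is_weight_powR v q : is_weight v -> is_weight (fun k => v k `^ q).
Proof. by move=> wv k k1; rewrite powR_gt0// wv. Qed.

(* Lerner's argument: the power [q - 1] of an average is controlled by the
   composition of two weighted maximal operators, each bounded for free. *)
Lemma muckenhoupt_sum q v K F N : 1 < q -> is_weight v -> 0 <= K ->
  (forall n, (1 <= n)%N ->
     avg v n * (avg (fun k => v k `^ (- (q - 1)^-1)) n) `^ (q - 1) <= K) ->
  (forall k, (1 <= k)%N -> 0 <= F k) ->
  \sum_(1 <= k < N) v k * tail_max (avg F) k N `^ q <=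
  K `^ (q / (q - 1)) * (q `^ (q / (q - 1)) * ((q / (q - 1)) `^ q *
    \sum_(1 <= k < N) v k * F k `^ q)).
Proof.
move=> q1 wv K0 HK F0; set q' := q / (q - 1).
pose s k := v k `^ (- (q - 1)^-1); rewrite -/s in HK.
have ws : is_weight s by exact: is_weight_powR.
have q10 : 0 < q - 1 by lra.
have q'1 : 1 < q' by rewrite /q' ltr_pdivlMr// mul1r; lra.
have qq' : (q - 1) * q' = q by rewrite mulrC divfK// gt_eqF.
have q'E : q' / (q' - 1) = q by rewrite /q'; field; lra.
pose AF n := (\sum_(1 <= j < n.+1) F j) / (\sum_(1 <= j < n.+1) s j).
set T := tail_max AF.
(* [T] is the maximal function of [F / s] for the measure [s], and [U] below is that of [c / v] for
   the measure [v], used with the conjugate exponent [q'], for which [c ^ q' = T ^ q]. *)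
pose c k := T k N `^ (q - 1).
have c0 k : (1 <= k)%N -> 0 <= c k by rewrite powR_ge0.
pose Ac n := (\sum_(1 <= j < n.+1) c j) / (\sum_(1 <= j < n.+1) v j).
set U := tail_max Ac.
have H1 := @weighted_maximal R q s F N q1 ws F0.
have H2 := @weighted_maximal R q' v c N q'1 wv c0.
rewrite -/Ac -/U q'E in H2; rewrite -/AF -/T in H1.
have U0 k : 0 <= U k N by exact: tail_max_ge0.
have AU k : (1 <= k)%N -> tail_max (avg F) k N <= (K * U k N) `^ (q - 1)^-1.
  move=> k1; apply: tail_max_le; first exact: powR_ge0.
  move=> n /andP[kn nN]; have n1 : (1 <= n)%N by exact: leq_trans kn.
  have A0 : 0 <= avg F n by exact: avg_ge0.
  rewrite -(powR_invK A0 (lt0r_neq0 q10)).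
  apply: ler_powR2r; rewrite ?powR_ge0 ?invr_ge0 ?(ltW q10)//.
  have Vp := weight_sum_gt0 wv n1; have Sp := weight_sum_gt0 ws n1.
  have np : (0 : R) < n%:R by rewrite ltr0n.
  set X := (\sum_(1 <= j < n.+1) F j) / (\sum_(1 <= j < n.+1) s j).
  have X0 : 0 <= X.
    by rewrite divr_ge0 ?(ltW Sp)// sumr_nat_ge0// => i /andP[/F0].
  have -> : avg F n = X * avg s n.
    by rewrite /avg mulrCA [X * _]divfK ?gt_eqF.
  have as0 : 0 <= avg s n by apply/ltW/avg_gt0.
  rewrite powRM//.
  (* For every [j <= n] the index [n] lies in the tail of [j], so [X <= T j N]; sum the powers over
     [j]. *)
  have XC : n%:R * X `^ (q - 1) <= \sum_(1 <= j < n.+1) c j.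
    have -> : n%:R * X `^ (q - 1) = \sum_(1 <= j < n.+1) X `^ (q - 1).
      by rewrite sumr_const_nat subSS subn0 mulr_natl.
    apply: ler_sum_nat => j /andP[j1 jn].
    apply: ler_powR2r => //; first exact: ltW.
    by apply: (@le_tail_max R AF j n N); rewrite nN andbT -ltnS.
  have VU : (\sum_(1 <= j < n.+1) c j) / (\sum_(1 <= j < n.+1) v j) <= U k N.
    by apply: (@le_tail_max R Ac k n N); rewrite kn.
  apply: le_trans (ler_wpM2l K0 VU).
  rewrite mulrA ler_pdivlMr//.
  (* Regrouped so that the product bounded by [K] appears as one factor. *)
  have -> : X `^ (q - 1) * avg s n `^ (q - 1) * \sum_(1 <= j < n.+1) v j =
    (n%:R * X `^ (q - 1)) * (avg v n * avg s n `^ (q - 1)).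
    rewrite /avg; set V := \sum_(1 <= j < n.+1) v j; field; lra.
  rewrite [K * _]mulrC; apply: ler_pM => //.
  - by rewrite mulr_ge0 ?powR_ge0// ltW.
  - by rewrite mulr_ge0 ?powR_ge0// ltW// avg_gt0.
  - exact: HK.
apply: (@le_trans _ _ (\sum_(1 <= k < N) K `^ q' * (v k * U k N `^ q'))).
  apply: ler_sum_nat => k /andP[k1 _].
  rewrite mulrCA ler_wpM2l ?is_weight_ge0// -powRM//.
  have -> : q' = (q - 1)^-1 * q by rewrite mulrC.
  rewrite powRrM; apply: ler_powR2r; first by lra.
    exact: tail_max_ge0.
  exact: AU.
rewrite -mulr_sumr ler_wpM2l ?powR_ge0//.
apply: (le_trans H2); rewrite ler_wpM2l ?powR_ge0//.
(* The output of the second operator is the input of the first: [v ^ (1 - q') = s]. At the end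
   [s ^ (1 - q) = v] returns to the original weight. *)
have -> : \sum_(1 <= k < N) v k * (c k / v k) `^ q' =
          \sum_(1 <= k < N) s k * T k N `^ q.
  apply: eq_big_nat => k /andP[k1 _]; have vk := wv _ k1.
  rewrite powRM ?powR_ge0 ?invr_ge0 ?(ltW vk)//.
  rewrite -powRrM qq' mulrCA mulrC; congr (_ * _).
  rewrite -[(v k)^-1]powR_inv1 ?(ltW vk)// -powRrM -{1}[v k]powRr1 ?(ltW vk)//.
  rewrite -powRD ?(gt_eqF vk) ?implybT//; congr (_ `^ _).
  by rewrite /q'; field; lra.
apply: (le_trans H1); rewrite ler_wpM2l ?powR_ge0//.
rewrite le_eqVlt; apply/orP; left; apply/eqP.
apply: eq_big_nat => k /andP[k1 _]; have vk := wv _ k1; have sk := ws _ k1.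
rewrite powRM ?F0 ?invr_ge0 ?(ltW sk)// mulrCA mulrC; congr (_ * _).
rewrite -[(s k)^-1]powR_inv1 ?(ltW sk)// -powRrM -{1}[s k]powRr1 ?(ltW sk)//.
rewrite -powRD ?(gt_eqF sk) ?implybT// -powRrM -[RHS]powRr1 ?(ltW vk)//.
by congr (_ `^ _); field; lra.
Qed.

End Maximal.

(** * Norms through partial sums, and finiteness of the operator norm *)

Section Norms.
Context {R : realType}.
Implicit Types (q K B : R) (v f : nat -> R) (F : nat -> \bar R) (m n N k : nat).
Local Open Scope ereal_scope.

Lemma poweR_le2r (x y : \bar R) q : (0 <= q)%R -> 0 <= x -> x <= y ->
  x `^ q <= y `^ q.
Proof.
move=> q0 x0 xy; apply: gt0_ler_poweR => //; rewrite in_itv/= leey andbT//.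
exact: le_trans xy.
Qed.

Lemma lq_normEE q v f : lq_norm q v f = lq_normE q v (fun k => `|f k|%:E).
Proof. by []. Qed.

(** With its converse [lq_normE_ge], this trades extended-real series for uniform bounds on real
    partial sums. Finiteness is asked only at [k >= 1], the indices that carry meaning. *)
Lemma lq_normE_le q v F f B : (0 < q)%R -> is_weight v -> (0 <= B)%R ->
  (forall k, (1 <= k)%N -> F k = (f k)%:E) ->
  (forall n, \sum_(1 <= k < n) v k * f k `^ q <= B `^ q)%R ->
  lq_normE q v F <= B%:E.
Proof.
move=> q0 wv B0 FE H; rewrite /lq_normE.
have T0 k : (1 <= k)%N -> xpredT k -> 0 <= (v k)%:E * F k `^ q.
  by move=> k1 _; rewrite mule_ge0 ?poweR_ge0// lee_fin (is_weight_ge0 wv).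
rewrite -(powR_invK B0 (lt0r_neq0 q0)) -poweR_EFin; apply: poweR_le2r.
- by rewrite invr_ge0 ltW.
- exact: nneseries_ge0.
- apply: lime_le; first exact: is_cvg_nneseries.
  apply: nearW => n; rewrite (@eq_big_nat _ _ _ _ _ _ (fun k => (v k * f k `^ q)%:E)).
    by rewrite sumEFin lee_fin.
  by move=> k /andP[k1 _]; rewrite FE.
Qed.

(** Since [v k] is strictly positive, an infinite [F k] would make its term, hence a partial sum,
    infinite. *)
Lemma lq_normE_ge q v F B : (0 < q)%R -> is_weight v ->
  (forall k, (1 <= k)%N -> 0 <= F k) -> lq_normE q v F <= B%:E ->
  (forall k, (1 <= k)%N -> F k \is a fin_num) /\
  (forall n, \sum_(1 <= k < n) v k * fine (F k) `^ q <= B `^ q)%R.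
Proof.
move=> q0 wv F0 H.
have T0 k : (1 <= k)%N -> xpredT k -> 0 <= (v k)%:E * F k `^ q.
  by move=> k1 _; rewrite mule_ge0 ?poweR_ge0// lee_fin (is_weight_ge0 wv).
have {}H n : \sum_(1 <= k < n) (v k)%:E * F k `^ q <= (B `^ q)%:E.
  apply: le_trans (nneseries_lim_ge n T0) _.
  rewrite -[leLHS]poweRe1; last exact: nneseries_ge0.
  rewrite -(mulVf (lt0r_neq0 q0)) poweRrM -poweR_EFin.
  by apply: poweR_le2r => //; [exact: ltW|exact: poweR_ge0].
have Ffin k : (1 <= k)%N -> F k \is a fin_num.
  move=> k1; rewrite ge0_fin_numE ?F0//.
  apply: (@lty_poweRy _ _ q); first exact: lt0r_neq0.
  have vk := wv _ k1.
  have : (v k)%:E * F k `^ q < +oo.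
    apply: le_lt_trans (ltry (B `^ q)); apply: le_trans (H k.+1).
    rewrite big_nat_recr//= leeDr// big_nat; apply: sume_ge0 => i /andP[i1 _].
    exact: T0.
  case: (F k `^ q) => [r _| |//]; first by rewrite ltry.
  by rewrite gt0_muley ?lte_fin.
split=> // n; rewrite -lee_fin -sumEFin; apply: le_trans (H n).
rewrite le_eqVlt; apply/orP; left; apply/eqP.
by apply: eq_big_nat => k /andP[k1 _]; rewrite -[in RHS](fineK (Ffin _ k1)).
Qed.

Lemma lq_norm_lty q v f : (0 < q)%R -> is_weight v ->
  (forall k, (1 <= k)%N -> 0 <= f k)%R -> lq_norm q v f < +oo ->
  exists2 A : R, (0 <= A)%R /\ lq_norm q v f = A%:E &
    (forall n, \sum_(1 <= k < n) v k * f k `^ q <= A `^ q)%R.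
Proof.
move=> q0 wv f0 fv; have fE : lq_norm q v f = (fine (lq_norm q v f))%:E.
  by rewrite fineK// ge0_fin_numE// poweR_ge0.
exists (fine (lq_norm q v f)); first by rewrite fine_ge0 ?poweR_ge0.
move=> n; have : lq_norm q v f <= (fine (lq_norm q v f))%:E by rewrite -fE.
rewrite lq_normEE => /(lq_normE_ge q0 wv (fun k _ => abse_ge0 (f k)%:E))[_ /(_ n)].
rewrite -lq_normEE; apply: le_trans; rewrite le_eqVlt; apply/orP; left; apply/eqP.
by apply: eq_big_nat => k /andP[k1 _] /=; rewrite ger0_norm// f0.
Qed.

Lemma avg_le_maxM f k n : (k <= n)%N -> (avg (fun j => `|f j|%R) n)%:E <= maxM f k.
Proof. by move=> kn; apply: ereal_sup_ubound; exists n. Qed.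

Lemma maxM_ge0 f k : 0 <= maxM f k.
Proof.
apply: le_trans (avg_le_maxM f (leqnn k)).
by rewrite lee_fin avg_ge0.
Qed.

Lemma maxM_half f k : maxM f k \is a fin_num ->
  exists n, (k <= n)%N /\ (fine (maxM f k) / 2 <= avg (fun j => `|f j|) n)%R.
Proof.
move=> fM; have := maxM_ge0 f k; rewrite -{1}(fineK fM) lee_fin le_eqVlt.
(* A zero supremum has no strictly smaller half to approximate, but there any average will do. *)
move=> /predU1P[<-|M0].
  by exists k; rewrite leqnn mul0r avg_ge0.
have : (fine (maxM f k) / 2)%:E < maxM f k.
  by rewrite -[ltRHS](fineK fM) lte_fin; lra.
by case/ereal_sup_gt => _ [n /= kn <-]; rewrite lte_fin => /ltW; exists n.
Qed.

(* Only finiteness matters here, so the supremum is replaced by an average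
   attaining at least half of it, which costs a factor [2 ^ q]. *)
Lemma muckenhoupt q v K : (1 < q)%R -> is_weight v -> (0 <= K)%R ->
  (forall n, (1 <= n)%N ->
     avg v n * (avg (fun k => v k `^ (- (q - 1)^-1)) n) `^ (q - 1) <= K)%R ->
  M_opnorm q v < +oo.
Proof.
move=> q1 wv K0 HK; have q0 : (0 < q)%R by lra.
pose C := (K `^ (q / (q - 1)) * (q `^ (q / (q - 1)) * (q / (q - 1)) `^ q))%R.
have C0 : (0 <= C)%R by rewrite !mulr_ge0 ?powR_ge0.
have C20 : (0 <= 2 `^ q * C)%R by rewrite mulr_ge0 ?powR_ge0.
apply: (@le_lt_trans _ _ (((2 `^ q * C) `^ q^-1)%R)%:E); last exact: ltry.
apply: ge_ereal_sup => _ [f /= f1 <-].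
have [_ {}f1] : (forall k, (1 <= k)%N -> `|f k|%:E \is a fin_num) /\
  (forall n, \sum_(1 <= k < n) v k * fine (`|f k|%:E) `^ q <= 1 `^ q)%R.
  exact: lq_normE_ge.
rewrite powR1 in f1.
have HC N : (\sum_(1 <= k < N) v k * tail_max (avg (fun j => `|f j|)) k N `^ q <= C)%R.
  have := @muckenhoupt_sum R q v K (fun j => `|f j|)%R N q1 wv K0 HK
    (fun k _ => normr_ge0 _).
  move/le_trans; apply.
  by rewrite (mulrA (q `^ _)%R) mulrA -/C ler_piMr.
(* A single term of the bound [HC n.+1] controls the average up to [n] by a quantity independent of
   [n]. *)
have Mfin k : (1 <= k)%N -> maxM f k \is a fin_num.
  move=> k1; rewrite ge0_fin_numE ?maxM_ge0//; have vk := wv _ k1.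
  apply: (@le_lt_trans _ _ (((C / v k) `^ q^-1)%R)%:E); last exact: ltry.
  apply: ge_ereal_sup => _ [n /= kn <-]; rewrite lee_fin.
  have kn1 : (k <= n < n.+1)%N by rewrite kn ltnSn.
  apply: (le_trans (le_tail_max (avg (fun j => `|f j|%R)) kn1)).
  rewrite -(powR_invK (tail_max_ge0 _ k n.+1) (lt0r_neq0 q0)).
  apply: ler_powR2r; rewrite ?powR_ge0 ?invr_ge0 ?(ltW q0)//.
  rewrite ler_pdivlMr// mulrC; apply: le_trans (HC n.+1).
  apply: (@term_le_sum R (fun k => v k * tail_max _ k n.+1 `^ q)%R).
    by move=> i /andP[i1 _]; rewrite mulr_ge0 ?powR_ge0 ?(is_weight_ge0 wv).
  by rewrite k1 ltnS.
apply: (@lq_normE_le q v (maxM f) (fun k => fine (maxM f k))) => //.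
- exact: powR_ge0.
- by move=> k k1; rewrite fineK// Mfin.
move=> n; rewrite powRVK ?lt0r_neq0//.
have /choice[h Hh] : forall k, exists m, (1 <= k)%N -> (k <= m)%N /\
    (fine (maxM f k) / 2 <= avg (fun j => `|f j|) m)%R.
  move=> k; have [k1|_] := ltnP 0 k; last by exists 0%N.
  by have [m Hm] := maxM_half (Mfin _ k1); exists m.
(* Finitely many indices [h k] are involved, so one truncation [N] captures all the chosen
   averages. *)
pose N := maxn n (\max_(1 <= k < n) (h k).+1).
have N_h k : (1 <= k < n)%N -> (k <= h k < N)%N.
  move=> /andP[k1 kn]; have [-> _] := Hh _ k1.
  rewrite /N leq_max; apply/orP; right.
  by apply: (@leq_bigmax_seq _ _ _ (fun k => (h k).+1)); rewrite ?mem_index_iota ?k1.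
apply: (@le_trans _ _ (\sum_(1 <= k < n)
    2 `^ q * (v k * tail_max (avg (fun j => `|f j|)) k N `^ q))%R).
  apply: ler_sum_nat => k kn; have [k1 _] := andP kn.
  rewrite mulrCA ler_wpM2l ?(is_weight_ge0 wv)// -powRM ?tail_max_ge0//.
  apply: ler_powR2r; [exact: ltW|exact/fine_ge0/maxM_ge0|].
  have [_ fk] := Hh _ k1; rewrite mulrC -ler_pdivrMr//; apply: (le_trans fk).
  exact: (le_tail_max (avg (fun j => `|f j|%R)) (N_h _ kn)).
rewrite -mulr_sumr ler_wpM2l ?powR_ge0//; apply: le_trans (HC N).
apply: ler_sum_nat_ub; last exact: leq_maxl.
by move=> i i1; rewrite mulr_ge0 ?powR_ge0 ?(is_weight_ge0 wv).
Qed.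

End Norms.

(** * Rubio de Francia's algorithm *)

Section RubioDeFrancia.
Context {R : realType}.
Implicit Types (q B : R) (v f F : nat -> R) (m n N k : nat).

(** Continuity of the power comes from its derivability at positive points; when [l = 0] the bounds
    force [u] to be constant. *)
Lemma cvgn_powR (u : nat -> R) (l q : R) : 0 < q -> (forall n, 0 <= u n <= l) ->
  (u @ \oo --> l)%classic -> ((fun n => u n `^ q) @ \oo --> l `^ q)%classic.
Proof.
move=> q0 u0l ul; have l0 : 0 <= l by have /andP[] := u0l 0%N; exact: le_trans.
move: l0; rewrite le_eqVlt => /predU1P[lE|lp].
  have -> : (fun n => u n `^ q) = (fun=> l `^ q).
    by apply/funext => n; congr (_ `^ _); have := u0l n; rewrite -lE => /le_anti.
  exact: cvg_cst.
apply: (@continuous_cvg _ _ _ _ _ u (fun x : R => x `^ q) l) => //.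
apply/differentiable_continuous/derivable1_diffP/derivable_powR.
by rewrite in_itv/= andbT.
Qed.

Lemma cvgn_sum_nat (u : nat -> nat -> R) (l : nat -> R) m n :
  (forall k, (m <= k < n)%N -> (u ^~ k @ \oo --> l k)%classic) ->
  ((fun j => \sum_(m <= k < n) u j k) @ \oo --> \sum_(m <= k < n) l k)%classic.
Proof.
move=> ul; rewrite [X in (_ --> X)%classic]big_nat.
under eq_cvg do rewrite big_nat.
by apply: cvg_big => //; exact: add_continuous.
Qed.

Section Bounded.
Variables (q : R) (v : nat -> R).
Hypotheses (q1 : 1 < q) (wv : is_weight v) (Mfin : (M_opnorm q v < +oo)%E).

Let q0 : 0 < q. Proof. exact: lt_trans q1. Qed.

Let opn := fine (M_opnorm q v).

Lemma M_opnorm_ge0 : (0 <= M_opnorm q v)%E.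
Proof.
apply: (@le_trans _ _ (lq_normE q v (maxM (fun=> 0)))); first exact: poweR_ge0.
apply: ereal_sup_ubound; exists (fun=> 0) => //=.
rewrite lq_normEE; apply: (@lq_normE_le R q v _ (fun=> 0) 1) => //= [k _|n].
- by rewrite normr0.
- by rewrite powR1 big1// => k _; rewrite powR0 ?mulr0 ?lt0r_neq0.
Qed.

(** The operator norm tests the unit ball only, so [f] is divided by [B] and the homogeneity of the
    maximal operator is used. *)
Lemma maxM_bound f B : (forall k, (1 <= k)%N -> 0 <= f k) -> 0 < B ->
  (forall n, \sum_(1 <= k < n) v k * f k `^ q <= B `^ q) ->
  (forall k, (1 <= k)%N -> maxM f k \is a fin_num) /\
  (forall n, \sum_(1 <= k < n) v k * fine (maxM f k) `^ q <= (opn * B) `^ q).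
Proof.
move=> f0 B0 fB; pose g k := f k / B.
have gf k : `|g k| = `|f k| / B by rewrite normrM [X in _ * X]gtr0_norm ?invr_gt0.
have avgE n : avg (fun j => `|g j|) n = avg (fun j => `|f j|) n / B.
  rewrite /avg -mulrA mulr_suml; congr (_ * _).
  by apply: eq_bigr => k _.
have maxE k : maxM f k = (B%:E * maxM g k)%E.
  rewrite /maxM -ereal_sup_pZl//; congr ereal_sup; apply/seteqP; split.
  - move=> _ [n kn <-]; exists (avg (fun j => `|g j|) n)%:E; first by exists n.
    by rewrite avgE -EFinM mulrC divfK ?gt_eqF.
  - move=> _ [_ [n kn <-] <-]; exists n => //.
    by rewrite avgE -EFinM mulrC divfK ?gt_eqF.
have : (lq_normE q v (maxM g) <= opn%:E)%E.
  rewrite fineK ?ge0_fin_numE ?M_opnorm_ge0//.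
  apply: ereal_sup_ubound; exists g => //=.
  rewrite lq_normEE; apply: (@lq_normE_le R q v _ g 1) => //.
  - by move=> k k1; rewrite ger0_norm// divr_ge0 ?f0// ltW.
  - move=> n; rewrite powR1 -(@ler_pM2r _ (B `^ q)) ?powR_gt0// mul1r mulr_suml.
    apply: le_trans (fB n); rewrite le_eqVlt; apply/orP; left; apply/eqP.
    apply: eq_big_nat => k /andP[k1 _]; rewrite -mulrA -powRM ?divfK ?gt_eqF//.
    - by rewrite divr_ge0 ?f0// ltW.
    - exact: ltW.
move=> /(lq_normE_ge q0 wv (fun k _ => maxM_ge0 g k))[gfin gB].
split=> [k k1|n]; first by rewrite maxE fin_numM// gfin.
rewrite powRM ?(ltW B0) ?fine_ge0 ?M_opnorm_ge0//.
rewrite -ler_pdivrMr ?powR_gt0// mulr_suml; apply: le_trans (gB n).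
rewrite le_eqVlt; apply/orP; left; apply/eqP; apply: eq_big_nat => k /andP[k1 _].
rewrite maxE fineM ?gfin//= powRM ?(ltW B0) ?fine_ge0 ?maxM_ge0//.
by rewrite mulrCA [B `^ q * _]mulrC mulfK// gt_eqF// powR_gt0.
Qed.

Lemma avg_le_fine_maxM f k n : maxM f k \is a fin_num ->
  (forall k, (1 <= k)%N -> 0 <= f k) -> (k <= n)%N ->
  avg f n <= fine (maxM f k).
Proof.
move=> fM f0 kn; rewrite -lee_fin fineK//; apply: le_trans (avg_le_maxM _ kn).
rewrite lee_fin le_eqVlt; apply/orP; left; apply/eqP; congr (_ * _).
by apply: eq_big_nat => j /andP[j1 _]; rewrite ger0_norm// f0.
Qed.

Lemma le_maxM (f g : nat -> R) k : (forall j, (1 <= j)%N -> `|f j| <= `|g j|) ->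
  (maxM f k <= maxM g k)%E.
Proof.
move=> fg; apply: ge_ereal_sup => _ [n kn <-].
apply: le_trans (avg_le_maxM _ kn); rewrite lee_fin /avg ler_wpM2l ?invr_ge0//.
by apply: ler_sum_nat => j /andP[/fg].
Qed.

(** Test on the unit mass at [1], whose maximal function is at least [1] there. This permits
    division by [2 * opn] and later keeps the argument of [phi] above [1]. *)
Lemma M_opnorm_ge1 : 1 <= opn.
Proof.
pose d k : R := (k == 1%N)%:R; have v1 := wv (leqnn 1).
have d0 k : (1 <= k)%N -> 0 <= d k by rewrite /d ler0n.
have B0 : 0 < v 1%N `^ q^-1 by rewrite powR_gt0.
have dB n : \sum_(1 <= k < n) v k * d k `^ q <= (v 1%N `^ q^-1) `^ q.
  rewrite powRVK ?(ltW v1) ?lt0r_neq0//; case: n => [|[|n]].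
  - by rewrite big_geq// ltW.
  - by rewrite big_geq// ltW.
  rewrite big_ltn// big_nat big1 ?addr0; first by rewrite /d eqxx powR1 mulr1.
  by move=> k /andP[k2 _]; rewrite /d gtn_eqF// powR0 ?mulr0 ?lt0r_neq0.
have [Mf MB] := maxM_bound d0 B0 dB.
have := MB 2%N; rewrite big_nat1 powRM ?(ltW B0) ?fine_ge0 ?M_opnorm_ge0//.
rewrite powRVK ?(ltW v1) ?lt0r_neq0// mulrC ler_pM2r// => H.
have m1 : 1 <= fine (maxM d 1).
  apply: le_trans (avg_le_fine_maxM (Mf 1%N isT) d0 (leqnn 1)).
  by rewrite /avg invr1 mul1r big_nat1 /d eqxx.
apply: (le_trans m1); rewrite leNgt; apply/negP => lt_opn.
move: H; apply/negP; rewrite -ltNge; apply: gt0_ltr_powR; rewrite ?nnegrE//.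
- exact/fine_ge0/M_opnorm_ge0.
- exact/fine_ge0/maxM_ge0.
Qed.

(* The majorant is the increasing limit of [u := F + M u / (2 ||M||)]. *)
Lemma rubio_de_francia F B : (forall k, (1 <= k)%N -> 0 <= F k) -> 0 < B ->
  (forall n, \sum_(1 <= k < n) v k * F k `^ q <= B `^ q) ->
  exists u : nat -> R, [/\ forall k, (1 <= k)%N -> F k <= u k,
    forall k n, (1 <= k)%N -> (k <= n)%N -> avg u n <= 2 * opn * u k &
    forall n, \sum_(1 <= k < n) v k * u k `^ q <= (2 * B) `^ q].
Proof.
move=> F0 B0 FB; have opn1 := M_opnorm_ge1.
have o0 : 0 < 2 * opn by rewrite mulr_gt0//; exact: lt_le_trans opn1.
have BB : 0 < 2 * B by rewrite mulr_gt0.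
pose step (f : nat -> R) k := F k + fine (maxM f k) / (2 * opn).
pose u j := iter j step F.
have uE j k : u j.+1 k = F k + fine (maxM (u j) k) / (2 * opn) by [].
have uB j : (forall k, (1 <= k)%N -> 0 <= u j k) /\
    (forall n, \sum_(1 <= k < n) v k * u j k `^ q <= (2 * B) `^ q).
  elim: j => [|j [u0 uB]].
    split=> // n; apply: (le_trans (FB n)); apply: ler_powR2r; [exact: ltW|exact: ltW|].
    by rewrite ler_peMl ?ler1n ?ltW.
  have [Mf MB] := maxM_bound u0 BB uB.
  have t0 k : 0 <= fine (maxM (u j) k) / (2 * opn).
    by rewrite divr_ge0 ?(ltW o0)// fine_ge0// maxM_ge0.
  split=> [k k1|n]; first by rewrite /= addr_ge0 ?F0.
  (* Dividing by [2 * opn] brings the bound [opn * (2 * B)] down to [B]. *)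
  have MB' : \sum_(1 <= k < n) v k * (fine (maxM (u j) k) / (2 * opn)) `^ q <= B `^ q.
    rewrite -(@ler_pM2r _ ((2 * opn) `^ q)) ?powR_gt0// mulr_suml -powRM ?(ltW B0) ?(ltW o0)//.
    rewrite (_ : B * _ = opn * (2 * B)); last by ring.
    apply: le_trans (MB n); rewrite le_eqVlt; apply/orP; left; apply/eqP.
    apply: eq_bigr => k _; rewrite -mulrA -powRM ?(ltW o0)//.
    by rewrite divfK ?gt_eqF.
  (* Midpoint convexity replaces Minkowski's inequality: both summands have norm at most [B], so
     their sum has norm at most [2 * B]. *)
  apply: (@le_trans _ _ (\sum_(1 <= k < n) 2 `^ q * (2^-1 * (v k * F k `^ q) +
      2^-1 * (v k * (fine (maxM (u j) k) / (2 * opn)) `^ q)))).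
    apply: ler_sum_nat => k /andP[k1 _].
    set x := F k; set y := fine _ / _.
    have x0 : 0 <= x by exact: F0.
    have y0 : 0 <= y by exact: t0.
    have -> : u j.+1 k = 2 * ((x + y) / 2) by rewrite /= /step -/x -/y; field.
    rewrite powRM ?divr_ge0 ?addr_ge0// mulrCA ler_wpM2l ?powR_ge0//.
    rewrite -!(mulrCA (v k)) -mulrDr ler_wpM2l ?(is_weight_ge0 wv)//.
    by rewrite -mulrDr [2^-1 * _]mulrC powR_midpoint_le.
  rewrite -mulr_sumr big_split/= -!mulr_sumr powRM ?(ltW B0)// ler_wpM2l ?powR_ge0//.
  by have := FB n; move: MB'; lra.
have Mf j k : (1 <= k)%N -> maxM (u j) k \is a fin_num.
  by move=> k1; have [u0 ub] := uB j; have [+ _] := maxM_bound u0 BB ub; exact.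
have uS j k : (1 <= k)%N -> u j k <= u j.+1 k.
  elim: j k => [|j IH] k k1.
    by rewrite /= /step lerDl divr_ge0 ?(ltW o0)// fine_ge0// maxM_ge0.
  have [u0 _] := uB j; have [u1 _] := uB j.+1.
  rewrite uE (uE j.+1) lerD2l ler_pM2r ?invr_gt0//.
  rewrite fine_le ?Mf//; apply: le_maxM => i i1.
  by rewrite !ger0_norm ?u0 ?u1// IH.
have u_nd k : (1 <= k)%N -> nondecreasing_seq (u ^~ k).
  by move=> k1; apply/nondecreasing_seqP => j; exact: uS.
(* One term of the norm bound, uniform in [j], makes the monotone iterates converge pointwise. *)
have u_ub j k : (1 <= k)%N -> u j k <= ((2 * B) `^ q / v k) `^ q^-1.
  move=> k1; have [u0 ub] := uB j; have vk := wv k1.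
  rewrite -(powR_invK (u0 _ k1) (lt0r_neq0 q0)).
  apply: ler_powR2r; rewrite ?powR_ge0 ?invr_ge0 ?(ltW q0)//.
  rewrite ler_pdivlMr// mulrC; apply: le_trans (ub k.+1).
  apply: (@term_le_sum R (fun k => v k * u j k `^ q)).
    by move=> i /andP[i1 _]; rewrite mulr_ge0 ?powR_ge0 ?(is_weight_ge0 wv).
  by rewrite k1 ltnS /=.
pose U k := limn (u ^~ k).
have u_cvg k : (1 <= k)%N -> (u ^~ k @ \oo --> U k)%classic.
  move=> k1; apply: nondecreasing_is_cvgn; first exact: u_nd.
  by exists (((2 * B) `^ q / v k) `^ q^-1) => _ [j _ <-]; exact: u_ub.
have u_le j k : (1 <= k)%N -> u j k <= U k.
  by move=> k1; apply: (nondecreasing_cvgn_le (u_nd _ k1)); exact/cvgP/u_cvg.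
exists U; split=> [k k1|k n k1 kn|n].
- exact: (u_le 0%N).
(* For each [j] the average of [u j] is at most [maxM (u j) k], hence at most [2 * opn * u j.+1 k]
   and [2 * opn * U k]; let [j] tend to infinity. *)
- have avg_cvg : ((fun j => avg (u j) n) @ \oo --> avg U n)%classic.
    apply: cvgM; first exact: cvg_cst.
    by apply: cvgn_sum_nat => i /andP[i1 _]; exact: u_cvg.
  apply: (cvgr_to_le avg_cvg); apply: nearW => j; have [u0 _] := uB j.
  apply: (le_trans (avg_le_fine_maxM (Mf j k k1) u0 kn)).
  rewrite -ler_pdivrMl// mulrC; apply: le_trans (u_le j.+1 _ k1).
  by rewrite /= /step lerDr F0.
- have s_cvg : ((fun j => \sum_(1 <= k < n) v k * u j k `^ q) @ \oo -->
      \sum_(1 <= k < n) v k * U k `^ q)%classic.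
    apply: cvgn_sum_nat => k /andP[k1 _]; apply: cvgM; first exact: cvg_cst.
    apply: cvgn_powR => //; last exact: u_cvg.
    by move=> j; rewrite u_le// andbT; have [+ _] := uB j; exact.
  by apply: (cvgr_to_le s_cvg); apply: nearW => j; have [] := uB j.
Qed.

End Bounded.
End RubioDeFrancia.

(** * Factored weights and extrapolation *)

Section Weights.
Context {R : realType}.
Implicit Types (q p K L : R) (u v w : nat -> R) (k n : nat).

Lemma le_Aq_const q w n : in_Aq q w -> (1 <= n)%N ->
  avg w n * (avg (fun k => w k `^ (- (q - 1)^-1)) n) `^ (q - 1)
  <= fine (Aq_const q w).
Proof.
move=> wA n1; set c := _ * _.
have cA : (c%:E <= Aq_const q w)%E by apply: ereal_sup_ubound; exists n.
have fA : Aq_const q w \is a fin_num.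
  by rewrite fin_numElt (lt_le_trans (ltNyr _) cA).
by rewrite -lee_fin fineK.
Qed.

(** At [n = 1] the product in the supremum is [w 1 / w 1]. *)
Lemma Aq_const_ge1 q w : 1 < q -> is_weight w -> in_Aq q w ->
  1 <= fine (Aq_const q w).
Proof.
move=> q1 ww wA; have w1 := ww 1%N isT.
apply: le_trans (le_Aq_const wA (leqnn 1)).
rewrite /avg invr1 !mul1r !big_nat1 -powRrM mulNr mulVf ?subr_eq0 ?gt_eqF//.
by rewrite powR_inv1 ?(ltW w1)// divff ?gt_eqF.
Qed.

Lemma Aq_const_le q w K :
  (forall n, (1 <= n)%N ->
    avg w n * (avg (fun k => w k `^ (- (q - 1)^-1)) n) `^ (q - 1) <= K) ->
  (Aq_const q w <= K%:E)%E.
Proof. by move=> wK; apply: ge_ereal_sup => _ [n /= n1 <-]; rewrite lee_fin wK. Qed.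

Lemma avg_powR_le u w t n : 0 < t -> t < 1 ->
  (forall k, (1 <= k)%N -> 0 <= u k) -> (forall k, (1 <= k)%N -> 0 <= w k) ->
  avg (fun k => u k `^ t * w k `^ (1 - t)) n <= avg u n `^ t * avg w n `^ (1 - t).
Proof.
move=> t0 t1 u0 w0; rewrite /avg.
have nV : (0 : R) <= n%:R^-1 by rewrite invr_ge0.
rewrite !powRM//; last 2 first.
- by rewrite sumr_nat_ge0// => k /andP[/w0].
- by rewrite sumr_nat_ge0// => k /andP[/u0].
rewrite mulrACA -powRD; last by rewrite addrC subrK oner_eq0.
rewrite [t + _]addrC subrK powRr1// ler_wpM2l// holder_sum// => k /andP[k1 _].
- exact: u0.
- exact: w0.
Qed.

(** Hoelder bounds the average of the product. In the dual average [u k >= avg u n / L] for [k <= n]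
    pulls the negative power of [u] out as a constant, leaving the dual weight of [w]. The averages
    of [u] then cancel. *)
Lemma Aq_factor (p0 : R) p u w L : 1 < p0 -> p0 < p -> is_weight u -> is_weight w ->
  in_Aq p w -> 0 < L ->
  (forall k n, (1 <= k)%N -> (k <= n)%N -> avg u n <= L * u k) ->
  (Aq_const p0 (fun k => (u k `^ ((p - p0) / (p - 1)) * w k `^ ((p0 - 1) / (p - 1)))%R)
   <= (L `^ ((p - p0) / (p - 1)) *
       fine (Aq_const p w) `^ ((p0 - 1) / (p - 1)))%:E)%E.
Proof.
move=> p01 p0p wu ww wA L0 uL; apply: Aq_const_le => n n1.
set t := (p - p0) / (p - 1).
have p10 : 0 < p - 1 by lra.
have p010 : 0 < p0 - 1 by lra.
have t0 : 0 < t by rewrite divr_gt0//; lra.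
have tE : (p0 - 1) / (p - 1) = 1 - t by rewrite /t; field; lra.
have t1 : t < 1 by rewrite -subr_gt0 -tE divr_gt0.
rewrite tE; pose s k := w k `^ (- (p - 1)^-1).
have ws : is_weight s by exact: is_weight_powR.
have a0 := avg_gt0 wu n1; have b0 := avg_gt0 ww n1; have s0 := avg_gt0 ws n1.
set a := avg u n in a0 *.
have La : 0 < L / a by rewrite divr_gt0.
have H1 : avg (fun k => u k `^ t * w k `^ (1 - t)) n <= a `^ t * avg w n `^ (1 - t).
  by apply: avg_powR_le => // k k1; exact: is_weight_ge0.
have H2 : avg (fun k => (u k `^ t * w k `^ (1 - t)) `^ (- (p0 - 1)^-1)) n `^ (p0 - 1)
    <= (L / a) `^ t * avg s n `^ (p0 - 1).
  have -> : (L / a) `^ t * avg s n `^ (p0 - 1) =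
      ((L / a) `^ (t / (p0 - 1)) * avg s n) `^ (p0 - 1).
    by rewrite (powRM _ (powR_ge0 _ _) (ltW s0)) -powRrM divfK ?gt_eqF.
  apply: ler_powR2r; first exact: ltW.
    by apply: avg_ge0 => k _; exact: powR_ge0.
  rewrite /avg mulrCA ler_wpM2l ?invr_ge0// mulr_sumr.
  apply: ler_sum_nat => k /andP[k1 kn]; have uk := wu _ k1; have wk := ww _ k1.
  rewrite powRM ?powR_ge0// -!powRrM.
  have -> : (1 - t) * - (p0 - 1)^-1 = - (p - 1)^-1 by rewrite -tE; field; lra.
  rewrite ler_wpM2r ?powR_ge0// mulrN powRN -powR_inv1 ?powR_ge0//.
  rewrite powRAC powR_inv1 ?(ltW uk)//.
  apply: ler_powR2r; first by rewrite divr_ge0// ltW.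
    by rewrite invr_ge0 ltW.
  by rewrite ler_pdivlMr// mulrC ler_pdivrMr// uL.
have s0' : 0 <= avg s n by exact: ltW.
apply: (le_trans (ler_pM _ (powR_ge0 _ _) H1 H2)).
  by apply: avg_ge0 => k _; rewrite mulr_ge0 ?powR_ge0.
rewrite mulrACA -powRM ?(ltW a0) ?(ltW La)// [a * _]mulrC divfK ?gt_eqF//.
rewrite ler_wpM2l ?powR_ge0//.
have -> : p0 - 1 = (p - 1) * (1 - t) by rewrite -tE mulrC divfK ?gt_eqF.
rewrite powRrM -powRM ?powR_ge0 ?(ltW b0)//.
apply: ler_powR2r; first by rewrite subr_ge0 ltW.
  by rewrite mulr_ge0 ?powR_ge0 ?ltW.
exact: le_Aq_const.
Qed.

(** Duality of the classes: [p' - 1 = (p - 1)^-1], so the dual of the dual weight is [w] and each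
    [A_p'] product is the [A_p] product of [w] to the power [(p - 1)^-1]. *)
Lemma M_opnorm_dual_lty p w : 1 < p -> is_weight w -> in_Aq p w ->
  (M_opnorm (p / (p - 1)) (fun k => (w k `^ (1 - p / (p - 1)))%R) < +oo)%E.
Proof.
move=> p1 ww wA; have p10 : 0 < p - 1 by lra.
have qE : p / (p - 1) - 1 = (p - 1)^-1 by field; lra.
have q1 : 1 < p / (p - 1) by rewrite -subr_gt0 qE invr_gt0.
have rE : 1 - p / (p - 1) = - (p - 1)^-1 by rewrite -opprB qE.
rewrite rE; pose v k := w k `^ (- (p - 1)^-1).
have wv : is_weight v by exact: is_weight_powR.
apply: (@muckenhoupt R _ _ (fine (Aq_const p w) `^ (p - 1)^-1)) => //.
  exact: powR_ge0.
move=> n n1; rewrite qE.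
have -> : avg (fun k => v k `^ (- (p - 1)^-1^-1)) n = avg w n.
  congr (_ * _); apply: eq_big_nat => k /andP[k1 _].
  by rewrite invrK -powRrM mulrNN mulVf ?gt_eqF// powRr1// is_weight_ge0.
have v0 := avg_gt0 wv n1; have w0 := avg_gt0 ww n1.
rewrite mulrC -(powR_invK (ltW v0) (lt0r_neq0 p10)) -powRM ?powR_ge0 ?(ltW w0)//.
apply: ler_powR2r; first by rewrite invr_ge0 ltW.
  by rewrite mulr_ge0 ?powR_ge0// ltW.
exact: le_Aq_const.
Qed.

End Weights.

Theorem theorem3p2 (R : realType) (p0 p : R) (f g : nat -> R) (phi : R -> R) :
  1 < p0 -> p0 < p ->
  (forall k, (1 <= k)%N -> 0 <= f k) ->
  (forall k, (1 <= k)%N -> 0 <= g k) ->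
  (forall x, 1 <= x -> 0 < phi x) ->
  (forall x y, 1 <= x -> x <= y -> phi x <= phi y) ->
  (forall w0 : nat -> R, is_weight w0 -> in_Aq p0 w0 ->
     (lq_norm p0 w0 f <= (phi (fine (Aq_const p0 w0)))%:E * lq_norm p0 w0 g)%E) ->
  forall w : nat -> R, is_weight w -> in_Aq p w ->
    (lq_norm p w f < +oo)%E ->
    let p' := p / (p - 1) in
    (lq_norm p w f <=
       (2 `^ ((p - p0) / ((p - 1) * p0)) *
        phi ((2 * fine (M_opnorm p' (fun k => w k `^ (1 - p')))) `^ ((p - p0) / (p - 1))
             * (fine (Aq_const p w)) `^ ((p0 - 1) / (p - 1))))%:E
       * lq_norm p w g)%E.
Proof.
move=> p01 p0p f0 g0 phi0 phi_le Hp0 w ww wA fw; cbv zeta; set p' := p / (p - 1).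
have p1 : 1 < p by lra.
have p10 : 0 < p - 1 by lra.
have pp : 0 < p by lra.
have p00 : 0 < p0 by lra.
have p'1 : 1 < p' by rewrite /p' ltr_pdivlMr// mul1r; lra.
have p'E : 1 - p' = - (p - 1)^-1 by rewrite /p'; field; lra.
set v := fun k => w k `^ (1 - p').
have wv : is_weight v by exact: is_weight_powR.
have Mfin : (M_opnorm p' v < +oo)%E by exact: M_opnorm_dual_lty.
set N := fine (M_opnorm p' v); set t := (p - p0) / (p - 1).
have N1 : 1 <= N by exact: M_opnorm_ge1.
have N2 : 1 <= 2 * N by lra.
set K := fine (Aq_const p w); have K1 : 1 <= K by exact: Aq_const_ge1.
have t0 : 0 < t by rewrite divr_gt0//; lra.
have tE : (p0 - 1) / (p - 1) = 1 - t by rewrite /t; field; lra.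
have t1 : 0 < 1 - t by rewrite -tE divr_gt0//; lra.
set x := (2 * N) `^ t * _.
have x1 : 1 <= x.
  have ge1 a r : 1 <= a -> 0 <= r -> 1 <= a `^ r.
    by move=> a1 r0; rewrite -[leLHS](powRr0 a) ler_powR.
  by rewrite mulr_ege1 ?ge1 ?tE ?(ltW t0) ?(ltW t1).
set e := _ / (_ * p0); set c := 2 `^ e * phi x.
have c0 : 0 < c by rewrite mulr_gt0 ?powR_gt0 ?phi0.
have [A [A0 fE] fA] := lq_norm_lty pp ww f0 fw; rewrite fE.
(* The trivial cases [A = 0] and [g] of infinite norm are removed first; the end of the proof
   divides by a power of [A]. *)
move: A0; rewrite le_eqVlt => /predU1P[<-|A0].
  by apply: mule_ge0; [rewrite lee_fin ltW|exact: poweR_ge0].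
have [gw|] := ltP (lq_norm p w g) +oo%E; last first.
  by rewrite leye_eq => /eqP->; rewrite gt0_muley ?lte_fin// leey.
have [G [G0 ->] gG] := lq_norm_lty pp ww g0 gw.
rewrite -EFinM lee_fin.
(* Chosen so that [v * F ^ p' = w * f ^ p]. *)
pose F k := f k `^ (p - 1) * w k; pose B := A `^ (p - 1).
have B0 : 0 < B by rewrite powR_gt0.
have BE : B `^ p' = A `^ p by rewrite -powRrM mulrC divfK ?gt_eqF.
have F0 k : (1 <= k)%N -> 0 <= F k.
  by move=> k1; rewrite mulr_ge0 ?powR_ge0// is_weight_ge0.
have FB n : \sum_(1 <= k < n) v k * F k `^ p' <= B `^ p'.
  rewrite BE; apply: le_trans (fA n).
  rewrite le_eqVlt; apply/orP; left; apply/eqP; apply: eq_big_nat => k /andP[k1 _].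
  have wk := ww _ k1; rewrite powRM ?powR_ge0 ?(ltW wk)// -powRrM.
  rewrite [(p - 1) * p']mulrC divfK ?gt_eqF// mulrCA mulrC; congr (_ * _).
  by rewrite -powRD ?(gt_eqF wk) ?implybT// subrK powRr1// ltW.
have [u [Fu uM uB]] := rubio_de_francia p'1 wv Mfin F0 B0 FB.
have [k0 k01 fk0] : exists2 k0, (1 <= k0)%N & 0 < f k0.
  apply: contrapT => /forall2NP fN.
  suff : (lq_norm p w f <= 0%:E)%E by rewrite fE lee_fin leNgt A0.
  rewrite lq_normEE; apply: (@lq_normE_le R p w _ (fun=> 0) 0) => // [k k1|n].
    have [/(_ k1)[]|/negP] := fN k; rewrite -leNgt => fk.
    by rewrite (_ : f k = 0) ?normr0//; apply/le_anti; rewrite fk f0.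
  by rewrite powR0 ?gt_eqF// big1// => k _; rewrite mulr0.
have wu : is_weight u.
  move=> k k1; have u0 i : (1 <= i)%N -> 0 <= u i.
    by move=> i1; apply: le_trans (Fu _ i1); exact: F0.
  (* The average up to [maxn k k0] includes [u k0 >= F k0 > 0], and it is at most [2 * N * u k];
     hence [u] is strictly positive everywhere. *)
  have := uM k (maxn k k0) k1 (leq_maxl _ _).
  move=> /(lt_le_trans _) H; rewrite -(@pmulr_rgt0 _ (2 * N)); last by lra.
  apply: H; rewrite mulr_gt0 ?invr_gt0 ?ltr0n ?leq_max ?k1//.
  apply: (@lt_le_trans _ _ (u k0)).
    by apply: lt_le_trans (Fu _ k01); rewrite mulr_gt0 ?powR_gt0// ww.
  by apply: term_le_sum => [i /andP[/u0]//|]; rewrite k01 ltnS leq_maxr.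
pose w0 k := u k `^ t * w k `^ ((p0 - 1) / (p - 1)).
have ww0 : is_weight w0.
  by move=> k k1; rewrite mulr_gt0// powR_gt0 ?wu ?ww.
have w0x : (Aq_const p0 w0 <= x%:E)%E.
  by apply: Aq_factor => //; lra.
have w0A : in_Aq p0 w0 by apply: le_lt_trans w0x _; rewrite ltry.
have w01 := Aq_const_ge1 p01 ww0 w0A.
have phix : phi (fine (Aq_const p0 w0)) <= phi x.
  apply: phi_le => //; rewrite -lee_fin fineK// fin_numElt w0A andbT.
  apply: lt_le_trans (_ : 1%:E <= _)%E; first exact: ltNyr.
  by move: w01; case: (Aq_const p0 w0) w0A => [r|//|]; rewrite /= ?lee_fin// ler10.
(* [D] is what Hoelder with exponents [p0 / p] and [s] yields from the norm bounds [G] for [g] and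
   [2 * B] for [u]. *)
pose s := 1 - p0 / p; pose D := G * ((2 * B) `^ (p' * s)) `^ p0^-1.
have D0 : 0 <= D by rewrite mulr_ge0 ?powR_ge0.
have gD : (lq_norm p0 w0 g <= D%:E)%E.
  rewrite lq_normEE; apply: (@lq_normE_le R p0 w0 _ g D p00 ww0 D0) => [k k1|n].
    by rewrite ger0_norm// g0.
  rewrite /D (powRM _ G0 (powR_ge0 _ _)) (powRVK (powR_ge0 _ _) (lt0r_neq0 p00)).
  rewrite powRrM (_ : G `^ p0 = (G `^ p) `^ (p0 / p)); last first.
    by rewrite -powRrM mulrCA divff ?mulr1 ?gt_eqF.
  have r0 : 0 < p0 / p by rewrite divr_gt0.
  have r1 : p0 / p < 1 by rewrite ltr_pdivrMr// mul1r.
  have s0 : 0 <= s by rewrite subr_ge0 ltW.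
  have v0 k : (1 <= k)%N -> 0 <= v k by exact: is_weight_ge0.
  have w0' k : (1 <= k)%N -> 0 <= w k by exact: is_weight_ge0.
  apply: (@le_trans _ _ ((\sum_(1 <= k < n) w k * g k `^ p) `^ (p0 / p) *
     (\sum_(1 <= k < n) v k * u k `^ p') `^ s)); last first.
    apply: ler_pM; rewrite ?powR_ge0//.
      apply: ler_powR2r => //; first exact: ltW.
      by rewrite sumr_nat_ge0// => k /andP[/w0' ? _]; rewrite mulr_ge0 ?powR_ge0.
    apply: ler_powR2r => //.
    by rewrite sumr_nat_ge0// => k /andP[/v0 ? _]; rewrite mulr_ge0 ?powR_ge0.
  (* The splitting is [w0 * g ^ p0 = (w * g ^ p) ^ (p0 / p) * (v * u ^ p') ^ s], where
     [p' * s = t]. *)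
  apply: le_trans (@holder_sum R _ _ (p0 / p) 1 n r0 r1 _ _); last 2 first.
  - by move=> k /andP[/w0' ? _]; rewrite mulr_ge0 ?powR_ge0.
  - by move=> k /andP[/v0 ? _]; rewrite mulr_ge0 ?powR_ge0.
  rewrite le_eqVlt; apply/orP; left; apply/eqP; apply: eq_big_nat => k /andP[k1 _].
  have wk := ww _ k1; have uk := wu _ k1.
  rewrite !powRM ?powR_ge0 ?w0' ?v0// -!powRrM.
  have -> : p * (p0 / p) = p0 by field; lra.
  have -> : p' * (1 - p0 / p) = t by rewrite /p' /t; field; lra.
  rewrite /w0 (_ : (p0 - 1) / (p - 1) = p0 / p + (1 - p') * s); last first.
    by rewrite /p' /s; field; lra.
  by rewrite powRD ?(gt_eqF wk) ?implybT//; ring.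
have fD : (lq_norm p0 w0 f <= (phi x * D)%:E)%E.
  apply: (le_trans (Hp0 w0 ww0 w0A)); rewrite EFinM.
  apply: lee_pmul => //; rewrite ?lee_fin ?poweR_ge0//.
  exact/ltW/phi0.
have xD0 : 0 <= phi x * D by rewrite mulr_ge0// ltW// phi0.
have : (lq_norm p w f <= (((phi x * D) `^ p0) `^ p^-1)%:E)%E.
  rewrite lq_normEE; apply: (@lq_normE_le R p w _ f _ pp ww (powR_ge0 _ _)).
    by move=> k k1; rewrite ger0_norm// f0.
  move: fD; rewrite lq_normEE => /(lq_normE_ge p00 ww0 (fun k _ => abse_ge0 (f k)%:E)).
  move=> [_ fD] n; rewrite powRVK ?powR_ge0 ?gt_eqF//; apply: le_trans (fD n).
  apply: ler_sum_nat => k /andP[k1 _] /=; rewrite ger0_norm ?f0//.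
  have wk := ww _ k1; have fk := f0 _ k1.
  (* With [F] in place of [u] in [w0] the term is exactly [w * f ^ p], because
     [(p - 1) * t + p0 = p]. *)
  apply: (@le_trans _ _ (F k `^ t * w k `^ ((p0 - 1) / (p - 1)) * f k `^ p0)).
    rewrite tE powRM ?powR_ge0 ?(ltW wk)// -powRrM.
    rewrite (_ : (p - 1) * t = p - p0); last by rewrite mulrC divfK ?gt_eqF.
    rewrite -[X in X <= _]mulr1 -mulrA -[_ * _ * w k `^ _]mulrA.
    rewrite -powRD ?(gt_eqF wk) ?implybT// [t + _]addrC subrK powRr1 ?(ltW wk)//.
    by rewrite mulr1 mulrAC -powRD subrK ?(gt_eqF pp)// mulrC.
  rewrite ler_wpM2r ?powR_ge0// ler_wpM2r ?powR_ge0//.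
  by apply: ler_powR2r; [exact: ltW|exact: F0|exact: Fu].
(* Raised to the power [p / p0], the estimate reads [A ^ (p / p0) <= phi x * G * (2 * B) ^ e]. As
   [B ^ e = A ^ (p / p0 - 1)], cancelling this factor leaves [A] and the constant [2 ^ e]. *)
rewrite fE lee_fin -powRrM => /(@ler_powR2r _ _ _ (p / p0)).
rewrite divr_ge0 ?(ltW pp) ?(ltW p00)// (ltW A0) => /(_ isT isT).
rewrite -powRrM (_ : p0 / p * (p / p0) = 1) ?powRr1//; last by field; lra.
rewrite /D -powRrM (_ : p' * s / p0 = e); last by rewrite /p' /s /e; field; lra.
rewrite powRM ?(ltW B0)// -powRrM.
rewrite (_ : (p - 1) * e = p / p0 - 1); last by rewrite /e; field; lra.
rewrite (_ : A `^ (p / p0) = A * A `^ (p / p0 - 1)); last first.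
  by rewrite mulr_powRB1 ?(ltW A0)// divr_gt0.
rewrite !mulrA ler_pM2r ?powR_gt0// => /le_trans; apply.
by rewrite /c le_eqVlt; apply/orP; left; apply/eqP; ring.
Qed.
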